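(* Let $q,r$ be real piecewise continuous functions on $[a,b]$ such that the Dirichlet problem $-y''+q(x)y=\lambda r(x)y$, $y(a)=y(b)=0$ is non-definite. Then there is no non-trivial complex ghost $y=\varphi+i\psi$ (with $\varphi={\rm Re}\,y$, $\psi={\rm Im}\,y$) of this problem whose real and imaginary parts $\varphi,\psi$ have zeros that separate one another on the interval $[a,b]$ with the endpoints included.
   Context: The problem is called non-definite if each of the quadratic forms $y\mapsto\int_a^b(|y'|^2+q|y|^2)\,dx$ and $y\mapsto\int_a^b r|y|^2\,dx$ takes both positive and negative values on the domain of the Dirichlet problem. Solutions are $C^1$ functions with absolutely continuous derivative satisfying the equation almost everywhere. A complex ghost is a non-trivial eigenfunction $y$ belonging to a non-real eigenvalue $\lambda$. ''The zeros of $\varphi$ and $\psi$ separate one another on $[a,b]$ with endpoints included'' means: for any two consecutive zeros $x_1<x_2$ in $[a,b]$ of one of the two functions (where $x_1=a$ and $x_2=b$ are allowed, and consecutive means that this function has no zero in $(x_1,x_2)$) there is exactly one zero of the other function in the open interval $(x_1,x_2)$. *)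

(* Defs.v *)
From HB Require Import structures.
From mathcomp Require Import all_boot all_order all_algebra.
From mathcomp Require Import complex.
From mathcomp Require Import all_classical all_reals all_analysis.
Set Implicit Arguments.
Unset Strict Implicit.
Unset Printing Implicit Defensive.
Import Order.TTheory GRing.Theory Num.Theory.
Import numFieldNormedType.Exports.

Local Open Scope classical_set_scope.
Local Open Scope ring_scope.
Local Open Scope complex_scope.
Import ComplexField.Normc.

Section Definitions.
Context {R : realType}.
Implicit Types (a b x : R) (f g q r : R -> R) (y : R -> R[i]).

(* Finitely many discontinuities in ]a, b[, and finite one-sided limits at
   every point of [a, b]; the values at the discontinuities are arbitrary. *)
Definition piecewise_continuous a b f : Prop :=
  [/\ exists s : seq R, forall x, a < x < b -> x \notin s -> {for x, continuous f},
      forall x, a <= x < b -> cvg (f t @[t --> x^'+]) &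
      forall x, a < x <= b -> cvg (f t @[t --> x^'-])].

(* Derivatives on [a, b] are one-sided at the endpoints: y is only meant to be
   known on [a, b]. *)
Definition derivable_on a b f x : Prop :=
  cvg ((f t - f x) / (t - x) @[t --> within `[a, b] x^']).

Definition derive_on a b f x : R :=
  lim ((f t - f x) / (t - x) @[t --> within `[a, b] x^']).

Definition abs_continuous_on a b f : Prop :=
  forall e : R, 0 < e -> exists2 d : R, 0 < d &
    forall (n : nat) (u v : nat -> R),
      (forall i, (i < n)%N -> [/\ a <= u i, u i <= v i & v i <= b]) ->
      trivIset `I_n (fun i => `]u i, v i[%classic) ->
      \sum_(i < n) (v i - u i) < d ->
      \sum_(i < n) `|f (v i) - f (u i)| < e.

Definition C1_AC a b f : Prop :=
  [/\ forall x, x \in `[a, b] -> derivable_on a b f x,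
      {within `[a, b], continuous (derive_on a b f)} &
      abs_continuous_on a b (derive_on a b f)].

Definition re_part y : R -> R := fun x => complex.Re (y x).
Definition im_part y : R -> R := fun x => complex.Im (y x).

Definition cderivable_on a b y x : Prop :=
  derivable_on a b (re_part y) x /\ derivable_on a b (im_part y) x.

Definition cderive_on a b y : R -> R[i] :=
  fun x => derive_on a b (re_part y) x +i* derive_on a b (im_part y) x.

Definition dirichlet_domain a b y : Prop :=
  [/\ C1_AC a b (re_part y), C1_AC a b (im_part y), y a = 0 & y b = 0].

Definition energy_form a b q y : R :=
  \int[lebesgue_measure]_(x in `[a, b])
    (normc (cderive_on a b y x) ^+ 2 + q x * normc (y x) ^+ 2).

Definition weight_form a b r y : R :=
  \int[lebesgue_measure]_(x in `[a, b]) (r x * normc (y x) ^+ 2).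

Definition takes_both_signs (D : (R -> R[i]) -> Prop) (Q : (R -> R[i]) -> R) :=
  (exists2 y, D y & 0 < Q y) /\ (exists2 y, D y & Q y < 0).

Definition non_definite a b q r : Prop :=
  takes_both_signs (dirichlet_domain a b) (energy_form a b q) /\
  takes_both_signs (dirichlet_domain a b) (weight_form a b r).

Definition dirichlet_solution a b q r (lam : R[i]) y : Prop :=
  dirichlet_domain a b y /\
  {ae lebesgue_measure, forall x, x \in `[a, b] ->
     cderivable_on a b (cderive_on a b y) x /\
     - cderive_on a b (cderive_on a b y) x + (q x)%:C * y x
       = lam * (r x)%:C * y x}.

Definition complex_ghost a b q r (lam : R[i]) y : Prop :=
  [/\ lam \isn't Num.real,
      exists2 x, x \in `[a, b] & y x != 0 &
      dirichlet_solution a b q r lam y].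

Definition consecutive_zeros a b f x1 x2 : Prop :=
  [/\ a <= x1, x1 < x2, x2 <= b, f x1 = 0 /\ f x2 = 0 &
      forall x, x1 < x < x2 -> f x != 0].

Definition zeros_separate a b f g : Prop :=
  forall x1 x2,
    (consecutive_zeros a b f x1 x2 -> exists! x, x1 < x < x2 /\ g x = 0) /\
    (consecutive_zeros a b g x1 x2 -> exists! x, x1 < x < x2 /\ f x = 0).

End Definitions.

(* Main.v *)
Require Import Defs.
From mathcomp Require Import all_boot all_order all_algebra.
From mathcomp Require Import complex.
From mathcomp Require Import all_classical all_reals all_analysis.
From mathcomp Require Import measurable_realfun ring lra.
Import Order.TTheory GRing.Theory Num.Theory.
Import numFieldNormedType.Exports.
Local Open Scope classical_set_scope.
Local Open Scope ring_scope.

(** A solution of the differential equation with [y a = y' a = 0] vanishes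
    identically, so a ghost satisfies [phi' a <> 0] or [psi' a <> 0]; by symmetry
    say [psi' a <> 0]. Then [a] is an isolated zero of [psi], and [psi] has a next
    zero [x1 <= b]. Separation puts a unique zero [t] of [phi] in [(a, x1)], so
    [a] and [t] are consecutive zeros of [phi], and separation again puts a zero
    of [psi] in [(a, t)], contradicting the choice of [x1]. *)

(** * Local-to-global induction and one-sided differentiability *)

(* Cousin's lemma, with tagged partitions replaced by additivity of [P]. *)
Lemma interval_induction (R : realType) (a b : R) (P : R -> R -> Prop) :
  a <= b ->
  (forall u v w, a <= u -> u <= v -> v <= w -> w <= b ->
    P u v -> P v w -> P u w) ->
  (forall x, a <= x <= b -> exists2 d, 0 < d &
    forall u v, a <= u -> u <= x -> x <= v -> v <= b -> v - u < d -> P u v) ->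
  P a b.
Proof.
move=> ab Padd Ploc.
pose S := [set x | a <= x <= b /\ P a x].
have Sa : S a.
  have aab : a <= a <= b by rewrite lexx.
  by split=> //; have [d d0] := Ploc a aab; apply => //; rewrite subrr.
have supS : has_sup S by split; [exists a | exists b => x [/andP[]]].
have Sle x : S x -> x <= sup S by exact: sup_upper_bound.
have supS_b : sup S <= b by apply: ge_sup; [exists a | move=> x [/andP[]]].
have [|d d0 Pd] := Ploc (sup S); first by rewrite Sle.
have d20 : 0 < d / 2 by lra.
have [c Sc cS] := sup_adherent d20 supS.
have [/andP[ac cb] Pac] := Sc.
have cs := Sle _ Sc.
(* The hypothesis at [sup S] spans both sides of it: it links [c], less than [d / 2] below, to any
   [t] less than [d / 2] above. Hence [S] would pass beyond its supremum unless [b] is within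
   reach. *)
have Pcont t : sup S <= t -> t <= b -> t < sup S + d / 2 -> S t.
  move=> st tb tsd; split; first by apply/andP; split; lra.
  apply: (Padd a c t) => //; first lra.
  by apply: Pd => //; lra.
have [bs|sb] := leP b (sup S + d / 4).
  by have [|||_] := Pcont b => //; lra.
by have := Sle _ (Pcont (sup S + d / 4) _ _ _); lra.
Qed.

(** Clearing the denominator makes the estimate valid at [t = x] as well, a point the punctured
    limit leaves out. *)
Lemma derive_on_approx (R : realType) (a b : R) (f : R -> R) (x e : R) :
  derivable_on a b f x -> 0 < e -> exists2 d, 0 < d &
    forall t, a <= t <= b -> `|t - x| < d ->
      `|f t - f x - derive_on a b f x * (t - x)| <= e * `|t - x|.
Proof.
move=> /cvgrPdist_le /[swap] e0 /(_ e e0).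
rewrite /dnbhs !near_withinE => /nbhs_ballP[d /= d0 H].
exists d => // t tab txd; have [->|tx] := eqVneq t x.
  by rewrite !subrr mulr0 subrr normr0 mulr0.
have := H t; rewrite -ball_normE /= distrC => /(_ txd tx).
rewrite in_itv /= => /(_ tab).
have tx0 : t - x != 0 by rewrite subr_eq0.
have -> : f t - f x - derive_on a b f x * (t - x) =
  - (derive_on a b f x - (f t - f x) / (t - x)) * (t - x).
  by field.
by rewrite normrM normrN; apply: ler_wpM2r.
Qed.

(** Since [x] lies between [s] and [t], the linearization errors at the two ends add up to at most
    [e * (x - s) + e * (t - x)], which is proportional to the length. This is the local estimate
    that [interval_induction] can sum. *)
Lemma derive_on_straddle (R : realType) (a b : R) (f : R -> R) (x M e : R) :
  derivable_on a b f x -> `|derive_on a b f x| <= M -> 0 < e ->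
  exists2 d, 0 < d &
    forall s t, a <= s -> s <= x -> x <= t -> t <= b -> t - s < d ->
      `|f t - f s| <= (M + e) * (t - s).
Proof.
move=> df fM e0; have [d d0 H] := derive_on_approx _ _ _ _ _ _ df e0.
exists d => // s t As sx xt tb tsd.
have Hs : `|f s - f x - derive_on a b f x * (s - x)| <= e * (x - s).
  have := H s; rewrite ler0_norm ?subr_le0// opprB; apply; last by lra.
  by apply/andP; split; lra.
have Ht : `|f t - f x - derive_on a b f x * (t - x)| <= e * (t - x).
  have := H t; rewrite ger0_norm ?subr_ge0//; apply; last by lra.
  by apply/andP; split; lra.
have -> : f t - f s = derive_on a b f x * (t - s)
   + ((f t - f x - derive_on a b f x * (t - x))
   - (f s - f x - derive_on a b f x * (s - x))) by ring.
apply: (le_trans (ler_normD _ _)); rewrite normrM mulrDl (ger0_norm (_ : 0 <= t - s)); last by lra.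
apply: lerD; first by apply: ler_wpM2r => //; lra.
by apply: (le_trans (ler_normB _ _)); nra.
Qed.

(** * Boundedness of piecewise continuous coefficients *)

Lemma cvg_within_bounded (R : realType) (f : R -> R) (D : set R) (x : R) :
  cvg (f t @[t --> within D (nbhs x)]) ->
  exists2 d, 0 < d & exists M, forall t, `|t - x| < d -> D t -> `|f t| <= M.
Proof.
move=> /cvgrPdist_le /(_ 1 ltr01).
rewrite near_withinE => /nbhs_ballP[d /= d0 H].
exists d => //; set L := lim _ in H; exists (`|L| + 1) => t txd Dt.
have := H t; rewrite -ball_normE /= distrC => /(_ txd Dt) fL.
have -> : f t = L - (L - f t) by ring.
by apply: (le_trans (ler_normB _ _)); rewrite lerD2l.
Qed.

(** Near [x] the one-sided limits bound [f] on either side and [f x] is a bound at [x] itself; local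
    bounds glue by taking maxima. *)
Lemma piecewise_continuous_bounded (R : realType) (a b : R) (f : R -> R) :
  a <= b -> piecewise_continuous a b f ->
  exists M, forall t, a <= t <= b -> `|f t| <= M.
Proof.
move=> ab [_ cvgr cvgl].
apply: (@interval_induction R a b
  (fun u v => exists M, forall t, u <= t <= v -> `|f t| <= M)) => //.
  move=> u v w _ uv vw _ [M HM] [M' HM']; exists (Num.max M M') => t /andP[ut tw].
  rewrite le_max; have [tv|vt] := leP t v; first by rewrite HM// ut.
  by rewrite orbC HM'// tw ltW.
move=> x /andP[ax xb].
have [dr dr0 [Mr Hr]] : exists2 d, 0 < d &
    exists M, forall t, `|t - x| < d -> x < t -> t <= b -> `|f t| <= M.
  have [xb'|bx] := ltP x b.
    have [|d d0 [M HM]] := @cvg_within_bounded R f (fun t => x < t) x.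
      by apply: cvgr; rewrite ax.
    by exists d => //; exists M => t tx xt _; exact: HM.
  (* At [x = b] no point of the interval lies to the right, so the choice is arbitrary. *)
  by exists 1 => //; exists 0 => t _ xt tb; lra.
have [dl dl0 [Ml Hl]] : exists2 d, 0 < d &
    exists M, forall t, `|t - x| < d -> t < x -> a <= t -> `|f t| <= M.
  have [ax'|xa] := ltP a x.
    have [|d d0 [M HM]] := @cvg_within_bounded R f (fun t => t < x) x.
      by apply: cvgl; rewrite xb andbT.
    by exists d => //; exists M => t tx xt _; exact: HM.
  by exists 1 => //; exists 0 => t _ xt tb; lra.
exists (Num.min dr dl); first by rewrite lt_min dr0.
move=> u v au ux xv vb; rewrite lt_min => /andP[udr udl].
exists (Num.max `|f x| (Num.max Mr Ml)) => t /andP[ut tv].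
rewrite !le_max; have [tx|xt|->] := ltgtP t x; last by rewrite lexx.
  by rewrite (Hl t) ?orbT//; [rewrite ltr0_norm; lra|lra].
by rewrite (Hr t) ?orbT//; [rewrite gtr0_norm; lra|lra].
Qed.

(** * Mean value inequalities, everywhere and almost everywhere *)

(** With slope [M + e'] in place of [M] the bound holds locally by straddling and is additive by the
    triangle inequality; then the slack tends to zero. *)
Lemma derive_on_mean_value (R : realType) (a b : R) (f : R -> R) (M u v : R) :
  a <= u -> u <= v -> v <= b ->
  (forall x, u <= x <= v -> derivable_on a b f x) ->
  (forall x, u <= x <= v -> `|derive_on a b f x| <= M) ->
  `|f v - f u| <= M * (v - u).
Proof.
move=> au uv vb df fM; apply/ler_addgt0Pr => e e0.
have [vu|neq] := leP v u.
  have -> : v = u by lra.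
  by rewrite !subrr normr0 mulr0 add0r ltW.
pose e' := e / (v - u); have e'0 : 0 < e' by rewrite divr_gt0// subr_gt0.
have -> : M * (v - u) + e = (M + e') * (v - u) by rewrite /e'; field; lra.
apply: (@interval_induction R u v
  (fun s t => `|f t - f s| <= (M + e') * (t - s))) => //.
  move=> s t w _ _ _ _ st tw.
  have -> : f w - f s = (f w - f t) + (f t - f s) by ring.
  by apply: (le_trans (ler_normD _ _)); lra.
move=> x xuv; have [d d0 H] :=
  derive_on_straddle _ _ _ _ _ _ _ (df x xuv) (fM x xuv) e'0.
by exists d => // s t us sx xt tv ts; apply: H => //; lra.
Qed.

(** Converts smallness of the measure of [U] into smallness of the sum of lengths that absolute
    continuity asks for. *)
Lemma sum_disjoint_itv_le (R : realType) (U : set R) (n : nat) (p q : nat -> R) :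
  measurable U ->
  (forall i, (i < n)%N -> p i <= q i /\ `]p i, q i[ `<=` U) ->
  trivIset `I_n (fun i => `]p i, q i[%classic) ->
  ((\sum_(i < n) (q i - p i))%:E <= lebesgue_measure U)%E.
Proof.
move=> mU pqU tpq.
have mitv (i : nat) : measurable (`]p i, q i[%classic : set R) by [].
have mcup : measurable (\big[setU/set0]_(i < n) `]p i, q i[%classic : set R).
  by apply: bigsetU_measurable => i _.
have -> : (\sum_(i < n) (q i - p i))%:E =
    lebesgue_measure (\big[setU/set0]_(i < n) `]p i, q i[%classic : set R).
  rewrite (@measure_semi_additive_ord_I _ _ _ lebesgue_measure
             (fun i => `]p i, q i[%classic))// -sumEFin.
  apply: eq_bigr => i _; rewrite /= (lebesgue_measure_itv `]p i, q i[ ) /= lte_fin.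
  have [//|qp] := ltP (p i) (q i).
  by have [pq _] := pqU i (ltn_ord i); congr (_%:E); lra.
apply: le_measure; rewrite ?inE//.
by rewrite -(bigcup_mkord n (fun i => `]p i, q i[%classic)) => x [i /= ni]; have [_] := pqU i ni; apply.
Qed.

(** A short interval around a point of [U] lies in [U] and is recorded as one []p, q[]; around any
    other point the slope bound [C] applies and nothing is recorded. [Num.max C 0] keeps the linear
    term nonnegative on recorded intervals. *)
Lemma increment_le_modulo_open (R : realType) (f : R -> R) (U : set R)
    (u v C : R) :
  open U -> u <= v ->
  (forall x, u <= x <= v -> ~ U x -> exists2 d, 0 < d &
    forall s t, u <= s -> s <= x -> x <= t -> t <= v -> t - s < d ->
      `|f t - f s| <= C * (t - s)) ->
  exists n (p q : nat -> R),
    [/\ forall i, (i < n)%N ->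
          [/\ u <= p i, p i <= q i, q i <= v & `]p i, q i[ `<=` U],
        trivIset `I_n (fun i => `]p i, q i[%classic) &
        `|f v - f u| <= Num.max C 0 * (v - u) + \sum_(i < n) `|f (q i) - f (p i)|].
Proof.
move=> oU uv locC.
apply: (@interval_induction R u v (fun s t => exists n (p q : nat -> R),
  [/\ forall i, (i < n)%N ->
        [/\ s <= p i, p i <= q i, q i <= t & `]p i, q i[ `<=` U],
      trivIset `I_n (fun i => `]p i, q i[%classic) &
      `|f t - f s| <= Num.max C 0 * (t - s)
                      + \sum_(i < n) `|f (q i) - f (p i)|])) => //.
  move=> s t w us st tw wv [n [p [q [pq tpq fst]]]] [m [p' [q' [pq' tpq' ftw]]]].
  (* Concatenation of the two families; intervals from different blocks are disjoint because [t]
     separates them. *)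
  pose cat (x y : nat -> R) i := if (i < n)%N then x i else y (i - n)%N.
  exists (n + m)%N, (cat p p'), (cat q q'); split.
  - move=> i inm; rewrite /cat; case: (ltnP i n) => ni.
      by have [? ? ? ?] := pq i ni; split => //; lra.
    have [|? ? ? ?] := pq' (i - n)%N; first by rewrite ltn_subLR.
    by split => //; lra.
  - move=> i j /= inm jnm [x []]; rewrite /= /cat !in_itv /=.
    case: (ltnP i n) => [ni|ni]; case: (ltnP j n) => [nj|nj] xi xj.
    + by apply: tpq => //; exists x; split; rewrite /= in_itv.
    + have [_ _ qt _] := pq i ni.
      have [|tp _ _ _] := pq' (j - n)%N; first by rewrite ltn_subLR.
      by exfalso; lra.
    + have [_ _ qt _] := pq j nj.
      have [|tp _ _ _] := pq' (i - n)%N; first by rewrite ltn_subLR.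
      by exfalso; lra.
    + rewrite -(subnK ni) -(subnK nj); congr (_ + _)%N.
      apply: tpq'; rewrite /= ?ltn_subLR//.
      by exists x; split; rewrite /= in_itv.
  - rewrite big_split_ord /=.
    rewrite (eq_bigr (fun i : 'I_n => `|f (q i) - f (p i)|)); last first.
      by move=> i _; rewrite /cat ltn_ord.
    rewrite (eq_bigr (fun i : 'I_m => `|f (q' i) - f (p' i)|)) => [|i _]; last first.
      by rewrite /cat ltnNge leq_addr /= addKn.
    have -> : f w - f s = (f w - f t) + (f t - f s) by ring.
    by apply: (le_trans (ler_normD _ _)); lra.
move=> x xuv; have [Ux|nUx] := pselect (U x).
  have /nbhs_ballP[d /= d0 dU] := open_nbhs_nbhs (conj oU Ux).
  exists d => // s t us sx xt tv ts.
  exists 1%N, (fun=> s), (fun=> t); split.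
  - move=> i _; split => //; first lra.
    move=> z; rewrite /= in_itv /= => zst; apply: dU.
    by rewrite -ball_normE /= ltr_norml; lra.
  - by move=> i j /=; rewrite !ltnS !leqn0 => /eqP -> /eqP ->.
  - rewrite big_ord1 lerDr mulr_ge0//; last lra.
    by rewrite le_max lexx orbT.
have [d d0 H] := locC x xuv nUx.
exists d => // s t us sx xt tv ts; exists 0%N, (fun=> 0), (fun=> 0); split => //.
rewrite big_ord0 addr0; apply: (le_trans (H _ _ us sx xt tv ts)).
by apply: ler_wpM2r; [lra|rewrite le_max lexx].
Qed.

(* The exceptional null set is enclosed in an open set so small that absolute
   continuity makes the increments of [f] inside it negligible. *)
Lemma abs_continuous_mean_value (R : realType) (a b : R) (f : R -> R)
    (M u v : R) :
  a <= u -> u <= v -> v <= b -> 0 <= M -> abs_continuous_on a b f ->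
  {ae lebesgue_measure, forall x, u <= x <= v ->
    derivable_on a b f x /\ `|derive_on a b f x| <= M} ->
  `|f v - f u| <= M * (v - u).
Proof.
move=> au uv vb M0 ac [N [mN N0 NP]]; apply/ler_addgt0Pr => e e0.
have [vu|neq] := leP v u.
  have -> : v = u by lra.
  by rewrite !subrr normr0 mulr0 add0r ltW.
(* Half of [e] pays for the slack in the slope over the whole length, the other half for the
   increments inside [U]. *)
pose e' := e / 2 / (v - u).
have e'0 : 0 < e' by rewrite !divr_gt0// subr_gt0.
have e20 : 0 < e / 2 by lra.
have [d d0 acd] := ac (e / 2) e20.
have [|U [oU NU Ud]] := @lebesgue_regularity_outer R N d mN _ d0.
  by rewrite [X in (X < _)%E](_ : _ = 0%E).
have mU : measurable U by exact: open_measurable.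
(* Outer regularity controls only the part of [U] outside [N]; the rest is null. *)
have Ud' : (lebesgue_measure U < d%:E)%E.
  have -> : lebesgue_measure U =
      (lebesgue_measure (U `\` N) + lebesgue_measure (U `&` N))%E.
    exact: measureDI.
  rewrite [X in (_ + X)%E](_ : _ = 0%E) ?adde0//.
  apply: (@subset_measure0 _ _ _ lebesgue_measure (U `&` N) N) => //.
  exact: measurableI.
have [|n [p [q [pq tpq fuv]]]] :=
    @increment_le_modulo_open R f U u v (M + e') oU uv.
  move=> x xuv nUx.
  have [df fM] : derivable_on a b f x /\ `|derive_on a b f x| <= M.
    by apply: contrapT => nP; apply/nUx/NU/NP => /(_ xuv).
  have [d' d'0 H] := derive_on_straddle _ _ _ _ _ _ _ df fM e'0.
  by exists d' => // s t us sx xt tv; apply: H => //; lra.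
have sum_lt : \sum_(i < n) `|f (q i) - f (p i)| < e / 2.
  apply: acd => //.
    by move=> i /pq[? ? ? _]; split => //; lra.
  rewrite -lte_fin; apply: le_lt_trans Ud'.
  by apply: sum_disjoint_itv_le => // i /pq[].
rewrite max_l in fuv; last lra.
have : (M + e') * (v - u) = M * (v - u) + e / 2 by rewrite /e'; field; lra.
by lra.
Qed.

(** * Uniqueness for the initial value problem *)

(** A contraction argument: let [m] be the maximum of [|f'| + |g'|], attained at [c]. The mean value
    inequality bounds [f] and [g] by [m * (v - u)], the equation then bounds the second derivatives
    by [L], and integrating back to [c] bounds [m] by a fraction of itself. The length
    [(4 * K + 1)^-1] gives both [v - u <= 1] and, when [u < v], [4 * K * (v - u) < 1]. *)
Lemma second_order_unique_short (R : realType) (a b K u v : R) (f g : R -> R) :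
  0 <= K -> C1_AC a b f -> C1_AC a b g ->
  {ae lebesgue_measure, forall x, a <= x <= b ->
    [/\ derivable_on a b (derive_on a b f) x,
        derivable_on a b (derive_on a b g) x,
        `|derive_on a b (derive_on a b f) x| <= K * (`|f x| + `|g x|) &
        `|derive_on a b (derive_on a b g) x| <= K * (`|f x| + `|g x|)]} ->
  a <= u -> u <= v -> v <= b -> v - u <= (4 * K + 1)^-1 ->
  f u = 0 -> g u = 0 -> derive_on a b f u = 0 -> derive_on a b g u = 0 ->
  forall x, u <= x <= v ->
    [/\ f x = 0, g x = 0, derive_on a b f x = 0 & derive_on a b g x = 0].
Proof.
move=> K0 [df cf acf] [dg cg acg] ode au uv vb vuK fu gu f'u g'u.
set f' := derive_on a b f in df cf acf ode f'u *.
set g' := derive_on a b g in dg cg acg ode g'u *.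
have inab x : u <= x <= v -> x \in `[a, b].
  by move=> /andP[ux xv]; rewrite in_itv /=; apply/andP; split; lra.
have contm : {within `[u, v], continuous (fun x => `|f' x| + `|g' x|)}.
  have sub : `[u, v] `<=` `[a, b].
    by move=> x; rewrite /= in_itv /= => /inab.
  move=> x; apply: cvgD; apply: cvg_norm.
    exact: (continuous_subspaceW sub cf).
  exact: (continuous_subspaceW sub cg).
have [c] := EVT_max uv contm.
rewrite in_itv /= => cuv; set m := _ + _ => Hm.
have f'm x : u <= x <= v -> `|f' x| <= m.
  by move=> xuv; apply: le_trans (Hm x xuv); rewrite lerDl.
have g'm x : u <= x <= v -> `|g' x| <= m.
  by move=> xuv; apply: le_trans (Hm x xuv); rewrite lerDr.
have m0 : 0 <= m by rewrite addr_ge0.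
have small h : C1_AC a b h -> h u = 0 ->
    (forall x, u <= x <= v -> `|derive_on a b h x| <= m) ->
    forall x, u <= x <= v -> `|h x| <= m * (v - u).
  move=> [dh _ _] hu h'm x /andP[ux xv].
  have -> : h x = h x - h u by rewrite hu subr0.
  apply: (@le_trans _ _ (m * (x - u))); last by apply: ler_wpM2l; lra.
  apply: (@derive_on_mean_value R a b) => //; first by lra.
    by move=> t /andP[ut tx]; apply/dh/inab; rewrite ut; lra.
  by move=> t /andP[ut tx]; apply: h'm; rewrite ut; lra.
have fm := small f (And3 df cf acf) fu f'm.
have gm := small g (And3 dg cg acg) gu g'm.
pose L := K * (m * (v - u) + m * (v - u)).
have L0 : 0 <= L by rewrite mulr_ge0// addr_ge0// mulr_ge0// subr_ge0.
have fgL x : u <= x <= v -> K * (`|f x| + `|g x|) <= L.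
  by move=> xuv; apply: ler_wpM2l => //; apply: lerD; [exact: fm|exact: gm].
have [uc cv] := andP cuv.
have inL x : u <= x <= c -> a <= x <= b /\ u <= x <= v.
  by move=> /andP[ux xc]; split; apply/andP; split; lra.
have f'c : `|f' c| <= L * (c - u).
  have -> : f' c = f' c - f' u by rewrite f'u subr0.
  apply: (@abs_continuous_mean_value R a b) => //; first by lra.
  have [N [mN N0 oN]] := ode; exists N; split=> // x nPx; apply: oN => Hx.
  apply: nPx => /inL[/Hx[df' _ f''K _] xuv].
  by split => //; apply: le_trans f''K _; exact: fgL.
have g'c : `|g' c| <= L * (c - u).
  have -> : g' c = g' c - g' u by rewrite g'u subr0.
  apply: (@abs_continuous_mean_value R a b) => //; first by lra.
  have [N [mN N0 oN]] := ode; exists N; split=> // x nPx; apply: oN => Hx.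
  apply: nPx => /inL[/Hx[_ dg' _ g''K] xuv].
  by split => //; apply: le_trans g''K _; exact: fgL.
(* [m <= 2 L (v - u) = 4 K m (v - u)^2] and [4 K (v - u)^2 < 1] *)
have K1 : 0 < 4 * K + 1 by lra.
have vu0 : 0 <= v - u by lra.
have vu1 : v - u <= 1.
  by apply: le_trans vuK _; rewrite invf_le1//; lra.
have vuK' : (4 * K + 1) * (v - u) <= 1.
  by rewrite mulrC -ler_pdivlMr// div1r.
have mz : m = 0.
  have mL : m <= 2 * (L * (v - u)).
    have : L * (c - u) <= L * (v - u) by apply: ler_wpM2l; lra.
    by rewrite {1}/m; lra.
  apply/eqP; rewrite eq_le m0 andbT leNgt; apply/negP => mpos.
  move: mL; rewrite /L.
  have -> : 2 * (K * (m * (v - u) + m * (v - u)) * (v - u)) =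
    m * (4 * K * (v - u) * (v - u)) by ring.
  rewrite ler_pMr// => h1.
  have [vu00|vupos] := eqVneq (v - u) 0; first by move: h1; rewrite vu00; lra.
  have vp : 0 < v - u by rewrite lt_neqAle eq_sym vupos.
  by nra.
have zero (z M : R) : `|z| <= M -> M = 0 -> z = 0.
  by move=> zM M0; apply/normr0_eq0/eqP; rewrite eq_le normr_ge0 andbT -M0.
move=> x xuv; split.
- by apply: zero (fm x xuv) _; rewrite mz mul0r.
- by apply: zero (gm x xuv) _; rewrite mz mul0r.
- exact: zero (f'm x xuv) mz.
- exact: zero (g'm x xuv) mz.
Qed.

(** The admissible length depends on [K] alone, so vanishing Cauchy data propagate from left to
    right; the implication from [Z u] to [Z] on [[u, v]] is additive. *)
Lemma second_order_unique (R : realType) (a b K : R) (f g : R -> R) :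
  a <= b -> 0 <= K -> C1_AC a b f -> C1_AC a b g ->
  {ae lebesgue_measure, forall x, a <= x <= b ->
    [/\ derivable_on a b (derive_on a b f) x,
        derivable_on a b (derive_on a b g) x,
        `|derive_on a b (derive_on a b f) x| <= K * (`|f x| + `|g x|) &
        `|derive_on a b (derive_on a b g) x| <= K * (`|f x| + `|g x|)]} ->
  f a = 0 -> g a = 0 -> derive_on a b f a = 0 -> derive_on a b g a = 0 ->
  forall x, a <= x <= b -> f x = 0 /\ g x = 0.
Proof.
move=> ab K0 Cf Cg ode fa ga f'a g'a.
pose Z x := [/\ f x = 0, g x = 0, derive_on a b f x = 0 & derive_on a b g x = 0].
suff H : Z a -> forall x, a <= x <= b -> Z x.
  by move=> x /H[|-> -> _ _].
apply: (@interval_induction R a b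
  (fun u v => Z u -> forall x, u <= x <= v -> Z x)) => //.
  move=> u v w _ uv vw _ Huv Hvw Zu x /andP[ux xw].
  have [xv|vx] := leP x v; first by apply: Huv => //; rewrite ux.
  by apply: Hvw; [apply: Huv => //; rewrite uv lexx|rewrite (ltW vx)].
move=> x _; exists (4 * K + 1)^-1; first by rewrite invr_gt0; lra.
move=> u v au ux xv vb /ltW vuK [? ? ? ?].
by apply: (@second_order_unique_short R a b K) => //; lra.
Qed.

(** * Consecutive zeros and separation *)

(** The nonzero slope keeps other zeros away from [a], so the infimum of the zeros in []a, b]]
    exceeds [a]; differentiability there makes it a zero too. *)
Lemma next_zero (R : realType) (a b : R) (f : R -> R) :
  a < b -> (forall x, a <= x <= b -> derivable_on a b f x) ->
  f a = 0 -> f b = 0 -> derive_on a b f a != 0 ->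
  exists x, consecutive_zeros a b f a x.
Proof.
move=> ab df fa fb f'a.
(* With half the slope as tolerance, a zero [t] near [a] would make the linear term at most half of
   itself. *)
have e0 : 0 < `|derive_on a b f a| / 2 by rewrite divr_gt0// normr_gt0.
have aab : a <= a <= b by rewrite lexx ltW.
have [d d0 Hd] := derive_on_approx _ _ _ _ _ _ (df a aab) e0.
have nz t : a < t -> t <= b -> t - a < d -> f t != 0.
  move=> at_ tb tad; apply/eqP => ft.
  have := Hd t; rewrite ft fa subrr sub0r normrN normrM.
  rewrite (gtr0_norm (_ : 0 < t - a)) ?subr_gt0// ltW// tb => /(_ isT tad).
  have : 0 < `|derive_on a b f a| * (t - a) by rewrite mulr_gt0 ?normr_gt0 ?subr_gt0.
  by lra.
pose Z := [set x | a < x <= b /\ f x = 0].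
have Zb : Z b by split => //; rewrite ab lexx.
have infZ : has_inf Z by split; [exists b | exists a => x [/andP[/ltW]]].
have Zle x : Z x -> inf Z <= x by apply: ge_inf; case: infZ.
have adi : Num.min b (a + d) <= inf Z.
  apply: lb_le_inf; first by exists b.
  move=> x [/andP[ax xb] fx]; rewrite ge_min; have [bx|xltb] := leP b x => //=.
  by rewrite leNgt; apply/negP => xad; have := nz x ax xb; rewrite fx eqxx => /(_ ltac:(lra)).
have ai : a < inf Z by apply: lt_le_trans adi; rewrite lt_min ab; lra.
have ib := Zle _ Zb.
exists (inf Z); split => //.
- split => //; apply/eqP; apply/negPn/negP => fi.
  have iab : a <= inf Z <= b by rewrite ltW.
  have [d' d'0 H] := derive_on_approx _ _ _ _ _ _ (df _ iab) ltr01.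
  set D := derive_on a b f (inf Z) in H.
  have D1 : 0 < `|D| + 1 by rewrite ltr_wpDl.
  (* A zero [z] this close to the infimum gives [|f (inf Z)| <= (|D| + 1) * (z - inf Z) < |f (inf
     Z)|]. *)
  have e'0 : 0 < Num.min d' (`|f (inf Z)| / (`|D| + 1)).
    by rewrite lt_min d'0 divr_gt0 ?normr_gt0.
  have [z [/andP[az zb] fz] zi] := inf_adherent e'0 infZ.
  have iz := Zle z (conj (introT andP (conj az zb)) fz).
  move: zi; rewrite -ltrBlDl lt_min => /andP[zd'].
  rewrite ltr_pdivlMr// => /lt_geF /negbT /negP; apply.
  have := H z; rewrite fz sub0r ger0_norm ?subr_ge0// mul1r ltW// zb => /(_ isT zd') Hz.
  have -> : f (inf Z) = - (- f (inf Z) - D * (z - inf Z)) - D * (z - inf Z) by ring.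
  apply: (le_trans (ler_normB _ _)); rewrite normrN normrM (ger0_norm (_ : 0 <= z - _)) ?subr_ge0//.
  by lra.
- move=> x /andP[ax xi]; apply/eqP => fx.
  have := Zle x; rewrite leNgt xi => /(_ _)/negP; apply => //.
  by split => //; rewrite ax /=; lra.
Qed.

Lemma first_zeros_not_separate (R : realType) (a b x1 : R) (f g : R -> R) :
  g a = 0 -> consecutive_zeros a b f a x1 ->
  zeros_separate a b f g -> False.
Proof.
move=> ga cf sep; have [_ ax1 x1b [fa _] fnz] := cf.
have [t [[/andP[at_ tx1] gt] tuniq]] := (sep a x1).1 cf.
have [|z [[/andP[az zt] fz] _]] := (sep a t).2.
  split => //; first by lra.
  move=> x /andP[ax xt]; apply/eqP => gx.
  have := tuniq x; rewrite ax gx => /(_ _)/esym; rewrite (lt_trans xt tx1).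
  by move=> /(_ (conj isT erefl)) xE; move: xt; rewrite xE ltxx.
by have := fnz z; rewrite az fz eqxx (lt_trans zt tx1) => /(_ isT).
Qed.

Lemma complex_equation_bound (R : realType) (lam w z : R[i]) (q r : R) :
  - w + (q%:C)%C * z = lam * (r%:C)%C * z ->
  `|complex.Re w| <= (`|q| + (`|complex.Re lam| + `|complex.Im lam|) * `|r|) *
                     (`|complex.Re z| + `|complex.Im z|) /\
  `|complex.Im w| <= (`|q| + (`|complex.Re lam| + `|complex.Im lam|) * `|r|) *
                     (`|complex.Re z| + `|complex.Im z|).
Proof.
case: lam w z => [al be] [w1 w2] [z1 z2] /= [E1 E2].
have -> : w1 = q * z1 - (al * r * z1 - be * r * z2) by lra.
have -> : w2 = q * z2 - (al * r * z2 + be * r * z1) by lra.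
have Hn (x : R) : 0 <= `|x| by [].
have N1 := mulr_ge0 (Hn q) (Hn z1).
have N2 := mulr_ge0 (Hn q) (Hn z2).
have N3 := mulr_ge0 (mulr_ge0 (Hn al) (Hn r)) (Hn z1).
have N4 := mulr_ge0 (mulr_ge0 (Hn al) (Hn r)) (Hn z2).
have N5 := mulr_ge0 (mulr_ge0 (Hn be) (Hn r)) (Hn z1).
have N6 := mulr_ge0 (mulr_ge0 (Hn be) (Hn r)) (Hn z2).
split.
  apply: (le_trans (ler_normB _ _)).
  have := ler_normB (al * r * z1) (be * r * z2); rewrite !normrM.
  by lra.
apply: (le_trans (ler_normB _ _)).
have := ler_normD (al * r * z2) (be * r * z1); rewrite !normrM.
by lra.
Qed.

Theorem lemma1 (R : realType) (a b : R) (q r : R -> R) (hab : a < b)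
    (hq : piecewise_continuous a b q) (hr : piecewise_continuous a b r)
    (hnd : non_definite a b q r) :
  ~ exists (lam : R[i]) (y : R -> R[i]),
      complex_ghost a b q r lam y /\ zeros_separate a b (re_part y) (im_part y).
Proof.
case=> lam [y [[_ [x0 x0ab yx0] [[Cf Cg ya yb] ode]] sep]].
set f := re_part y in Cf sep; set g := im_part y in Cg sep.
have fa : f a = 0 by rewrite /f /re_part ya.
have fb : f b = 0 by rewrite /f /re_part yb.
have ga : g a = 0 by rewrite /g /im_part ya.
have gb : g b = 0 by rewrite /g /im_part yb.
have deriv h : C1_AC a b h -> forall x, a <= x <= b -> derivable_on a b h x.
  by move=> [dh _ _] x xab; apply: dh; rewrite in_itv.
have [f'a|f'a] := eqVneq (derive_on a b f a) 0; last first.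
  have [x1 cz] := next_zero _ _ _ _ hab (deriv f Cf) fa fb f'a.
  exact: first_zeros_not_separate ga cz sep.
have [g'a|g'a] := eqVneq (derive_on a b g a) 0; last first.
  have [x1 cz] := next_zero _ _ _ _ hab (deriv g Cg) ga gb g'a.
  have sep' : zeros_separate a b g f by move=> x x'; case: (sep x x').
  exact: first_zeros_not_separate fa cz sep'.
have [Mq qM] := piecewise_continuous_bounded _ _ _ _ (ltW hab) hq.
have [Mr rM] := piecewise_continuous_bounded _ _ _ _ (ltW hab) hr.
have aab : a <= a <= b by rewrite lexx ltW.
pose K := Mq + (`|complex.Re lam| + `|complex.Im lam|) * Mr.
have Mq0 : 0 <= Mq := le_trans (normr_ge0 _) (qM a aab).
have Mr0 : 0 <= Mr := le_trans (normr_ge0 _) (rM a aab).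
have K0 : 0 <= K by rewrite addr_ge0// mulr_ge0// addr_ge0.
have x0ab' : a <= x0 <= b by move: x0ab; rewrite in_itv.
have [|fx0 gx0] := second_order_unique _ _ _ _ _ _ (ltW hab) K0 Cf Cg _
    fa ga f'a g'a _ x0ab'.
  have [N [mN N0 oN]] := ode; exists N; split => // x nPx; apply: oN => Hx.
  apply: nPx => xab.
  have [|[df' dg'] E] := Hx; first by rewrite in_itv.
  have qrK : `|q x| + (`|complex.Re lam| + `|complex.Im lam|) * `|r x| <= K.
    by apply: lerD; [exact: qM|apply: ler_wpM2l; [exact: addr_ge0|exact: rM]].
  have [f''K g''K] := complex_equation_bound _ _ _ _ _ _ E.
  by split => //; [apply: le_trans f''K _|apply: le_trans g''K _];
    apply: ler_wpM2r; rewrite ?addr_ge0.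
move: yx0; rewrite eq_complex negb_and /=.
by move: fx0 gx0; rewrite /f /g /re_part /im_part => -> ->; rewrite eqxx.
Qed.
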